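(* Let $a(n,m)$ denote the number of Arndt compositions of $n$ with exactly $m$ parts. For all integers $n,m\ge 0$, $$a(n,m)=\sum_{\ell=0}^{n-m-\lfloor m/2\rfloor}\binom{m + \ell - 1}{\ell}\binom{n - m - \ell - 1}{n - m - \lfloor m/2\rfloor - \ell}(-1)^{n - m -\lfloor m/2\rfloor - \ell}$$ (an empty sum being $0$). Moreover, for all $n\ge 3$ and $m\ge 2$, $$a(n,m)=a(n-1,m)+a(n-2,m) - a(n-3,m) + a(n-3,m-2).$$
   Context: A composition of $n\ge 0$ is a finite sequence $(\sigma_1,\dots,\sigma_\ell)$ of positive integers summing to $n$ (the empty composition is the composition of $0$ with $0$ parts). An Arndt composition is one with $\sigma_{2i-1}>\sigma_{2i}$ for every positive integer $i$ with $2i\le\ell$. Binomial coefficients are $\binom{a}{b}=a(a-1)\cdots(a-b+1)/b!$ for integer $a$ and nonnegative integer $b$ (so e.g. $\binom{-1}{0}=1$ and $\binom{a}{b}=0$ when $0\le a<b$). *)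

(* Defs.v *)
From mathcomp Require Import all_boot all_order all_algebra.
Set Implicit Arguments.
Unset Strict Implicit.
Unset Printing Implicit Defensive.
Import Order.TTheory GRing.Theory Num.Theory.

Definition is_composition (n : nat) (s : seq nat) : bool :=
  all (fun k => 0 < k) s && (sumn s == n).

(* Parts are numbered from 1. *)
Definition part (s : seq nat) (j : nat) : nat := nth 0 s j.-1.

Definition is_arndt (s : seq nat) : bool :=
  [forall i : 'I_(size s).+1,
     (0 < i) && (2 * i <= size s) ==> (part s (2 * i) < part s (2 * i - 1))].

(* Each part of a composition of n is at most n, so restricting the entries to
   'I_n.+1 loses nothing: see arndt_compositions_complete. *)
Definition arndt_compositions (n m : nat) : {set m.-tuple 'I_n.+1} :=
  [set t : m.-tuple 'I_n.+1 |
     is_composition n (map val t) && is_arndt (map val t)].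

Definition arndt_count (n m : nat) : nat := #|arndt_compositions n m|.

Lemma arndt_compositions_complete (n m : nat) (s : seq nat) :
  is_composition n s -> is_arndt s -> size s = m ->
  exists! t : m.-tuple 'I_n.+1, t \in arndt_compositions n m /\ map val t = s.
Proof.
move=> cs As sz.
have le_n x : x \in s -> x < n.+1.
  case/andP: cs => _ /eqP <-; rewrite ltnS; elim: (s) => //= y r IH.
  rewrite inE => /orP[/eqP->|/IH le_x]; first exact: leq_addr.
  exact: leq_trans le_x (leq_addl _ _).
have szt : size (map (@inord n) s) == m by rewrite size_map sz.
have vt : map val (map (@inord n) s) = s.
  rewrite -map_comp -[RHS]map_id; apply/eq_in_map => x /le_n lt_x /=.
  by rewrite inordK.
exists (Tuple szt); split=> [|u [_ vu]].
  by rewrite inE /= vt cs As.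
apply: val_inj; apply: (inj_map val_inj); by rewrite /= vt vu.
Qed.

Local Open Scope ring_scope.

Definition binomz (a : int) (b : nat) : rat :=
  (\prod_(i < b) (a - i%:Z)%:~R) / (b`!)%:R.

(* Main.v *)
Require Import Defs.
From mathcomp Require Import all_boot all_order all_algebra.
From mathcomp Require Import zify ring.
Import Order.TTheory GRing.Theory Num.Theory.
Local Open Scope ring_scope.

(** Let [a > b] be the first two parts of an Arndt composition.  If [a > b + 1],
    decreasing [a] by one yields an arbitrary Arndt composition of [n - 1]; if
    [a = b + 1 > 2], decreasing both parts yields one of [n - 2] of the same kind;
    if [(a, b) = (2, 1)], removing both parts yields one of [n - 3] with two parts
    fewer.  Writing [C_m] for the generating function of the compositions with [m]
    parts and [E_m] for that of the ones with [a = b + 1], this says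
    [(1 - x) C_(m+2) = E_(m+2)] and [(1 - x^2) E_(m+2) = x^3 C_m].  Eliminating [E]
    gives the recurrence, and solving gives
    [C_m = x^(m + k) (1 - x)^(-m) (1 + x)^(-k)] with [k = floor (m / 2)], whose
    coefficients are the claimed sums. *)

(** * The Arndt condition and the count on plain sequences *)

Section FirstPairRecursion.

Local Open Scope nat_scope.

Fixpoint arndt_rec (s : seq nat) : bool :=
  if s is a :: b :: r then (b < a) && arndt_rec r else true.

(** Numbering the pairs from zero removes the truncated [2 * i - 1]. *)
Lemma is_arndtP (s : seq nat) :
  reflect (forall i, (2 * i).+1 < size s -> nth 0 s (2 * i).+1 < nth 0 s (2 * i))
          (is_arndt s).
Proof.
apply: (iffP forallP) => [H i lti | H [i /= lti]].
  have lti' : i.+1 < (size s).+1 by lia.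
  have := H (Ordinal lti'); rewrite /part [nat_of_ord _]/=.
  have -> : (2 * i.+1).-1 = (2 * i).+1 by lia.
  have -> : (2 * i.+1 - 1).-1 = 2 * i by lia.
  by move/implyP; apply; lia.
apply/implyP => /andP[i0 li]; rewrite /part.
case: i i0 li lti => // i _ li _.
have -> : (2 * i.+1).-1 = (2 * i).+1 by lia.
have -> : (2 * i.+1 - 1).-1 = 2 * i by lia.
by apply: H; lia.
Qed.

Lemma arndt_recE (s : seq nat) : arndt_rec s = is_arndt s.
Proof.
have [p] := ubnP (size s); elim: p s => // p IHp [|a [|b r]] /=.
- by move=> _; apply/esym/is_arndtP.
- by move=> _; apply/esym/is_arndtP=> i /=; lia.
move=> lt_p; rewrite IHp; last by lia.
apply/andP/is_arndtP => [[lt_ba /is_arndtP Hr] [|i] lti //|H]; last split.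
- have E : 2 * i.+1 = (2 * i).+2 by lia.
  by move: lti; rewrite E /= => lti; apply: Hr; lia.
- exact: (H 0).
apply/is_arndtP => i lti.
have E : 2 * i.+1 = (2 * i).+2 by lia.
by have := H i.+1; rewrite E /=; apply; lia.
Qed.

Definition arndt_of (n m : nat) (s : seq nat) : bool :=
  [&& size s == m, is_composition n s & arndt_rec s].

(** Passes from tuples over ['I_n.+1] to plain sequences, for which an enumeration can be built
    recursively. *)
Lemma arndt_count_size (n m : nat) (l : seq (seq nat)) :
  uniq l -> (forall s, (s \in l) = arndt_of n m s) -> arndt_count n m = size l.
Proof.
move=> uniq_l mem_l.
pose f (t : m.-tuple 'I_n.+1) : seq nat := map val t.
have f_inj : injective f by move=> t u /(inj_map val_inj) /val_inj.
rewrite /arndt_count cardE -(size_map f).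
apply/perm_size/uniq_perm => //; first by rewrite (map_inj_uniq f_inj) enum_uniq.
move=> s; rewrite mem_l; apply/mapP/and3P.
  case=> t; rewrite mem_enum inE => /andP[cs As] ->.
  by rewrite size_map size_tuple eqxx arndt_recE.
case=> /eqP sz cs; rewrite arndt_recE => As.
have [t [[tin <-] _]] := @arndt_compositions_complete n m s cs As sz.
by exists t; rewrite ?mem_enum.
Qed.

(** * Recursive enumeration of the compositions *)

Definition cons21 (s : seq nat) : seq nat := [:: 2, 1 & s].

Definition incr_head (s : seq nat) : seq nat :=
  if s is a :: r then a.+1 :: r else [::].

(** Short sequences are left fixed so that the map is injective everywhere. *)
Definition incr_pair (s : seq nat) : seq nat :=
  if s is [:: a, b & r] then [:: a.+1, b.+1 & r] else s.

Lemma cons21_inj : injective cons21. Proof. by move=> s t []. Qed.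

Lemma incr_head_inj : injective incr_head.
Proof. by move=> [|a s] [|b t] //= [-> ->]. Qed.

Lemma incr_pair_inj : injective incr_pair.
Proof. by move=> [|a [|b s]] [|c [|d t]] //= [-> -> ->]. Qed.

(** Enumerates the case a = b + 1, with [prev] listing the possible tails. Naming [q] makes the call
    at n - 2 structural while [prev] is taken at n - 3. *)
Fixpoint tight_list (prev : nat -> seq (seq nat)) (n : nat) : seq (seq nat) :=
  match n with
  | (p.+1 as q).+2 => map cons21 (prev p) ++ map incr_pair (tight_list prev q)
  | _ => [::]
  end.

Lemma tight_listS (prev : nat -> seq (seq nat)) (n : nat) :
  tight_list prev n.+3 = map cons21 (prev n) ++ map incr_pair (tight_list prev n.+1).
Proof. by []. Qed.

Fixpoint extend_list (prev : nat -> seq (seq nat)) (n : nat) : seq (seq nat) :=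
  if n is p.+1 then tight_list prev n ++ map incr_head (extend_list prev p)
  else [::].

Lemma extend_listS (prev : nat -> seq (seq nat)) (n : nat) :
  extend_list prev n.+1 = tight_list prev n.+1 ++ map incr_head (extend_list prev n).
Proof. by []. Qed.

Fixpoint arndt_list (m n : nat) : seq (seq nat) :=
  match m with
  | 0 => if n is 0 then [:: [::]] else [::]
  | 1 => if n is 0 then [::] else [:: [:: n]]
  | p.+2 => extend_list (arndt_list p) n
  end.

Definition tight (s : seq nat) : bool := nth 0 s 0 == (nth 0 s 1).+1.

Section Step.

Variables (m : nat) (prev : nat -> seq (seq nat)).
Hypothesis prev_uniq : forall n, uniq (prev n).
Hypothesis mem_prev : forall n s, (s \in prev n) = arndt_of n m s.

Lemma arndt_of_cons2 (n a b : nat) (r : seq nat) :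
  arndt_of n m.+2 [:: a, b & r] =
  [&& 0 < b, b < a, a + b <= n & arndt_of (n - (a + b)) m r].
Proof.
rewrite /arndt_of /is_composition /= !eqSS.
have -> : (a + (b + sumn r) == n) = (a + b <= n) && (sumn r == n - (a + b)) by lia.
case: (size r == m); case: (all _ r); case: (arndt_rec r); case: (sumn r == _);
  rewrite ?andbF ?andbT //=; lia.
Qed.

Lemma arndt_of_short (n : nat) (s : seq nat) : size s < 2 -> arndt_of n m.+2 s = false.
Proof. by case: s => [|a []]. Qed.

Lemma mem_tight (n : nat) (s : seq nat) :
  (s \in tight_list prev n) = arndt_of n m.+2 s && tight s.
Proof.
have [p] := ubnP n; elim: p n s => // p IHp n s lt_np.
have [short_s|] := ltnP (size s) 2.
  rewrite arndt_of_short //; case: n lt_np => [|[|[|n]]] // lt_np.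
  rewrite tight_listS mem_cat; apply/norP; split; apply/mapP => -[t].
    by move=> _ Es; rewrite Es in short_s.
  rewrite IHp; last by lia.
  case: t => [|a [|b t]]; rewrite ?arndt_of_cons2 ?arndt_of_short //.
  by move=> _ Es; rewrite Es in short_s.
case: s => [|a [|b r]] // _.
case: n lt_np => [|[|[|n]]] lt_np; rewrite ?tight_listS arndt_of_cons2 /tight.
- by apply/esym/negP => /andP[/and4P[]]; lia.
- by apply/esym/negP => /andP[/and4P[]]; lia.
- by apply/esym/negP => /andP[/and4P[]]; lia.
rewrite mem_cat; apply/orP/andP => [[]/mapP[t]|].
- by rewrite mem_prev => Ht [-> -> ->]; rewrite !subSS subn0 Ht.
- rewrite IHp; last by lia.
  case: t => [|c [|d t]]; rewrite ?arndt_of_cons2 ?arndt_of_short // /tight /=.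
  move=> /andP[/and4P[d0 lt_dc le_n Ht] tt] [-> -> ->].
  have -> : n.+3 - (c.+1 + d.+1) = n.+1 - (c + d) by lia.
  by rewrite Ht; split; last lia; apply/and4P; split=> //; lia.
case=> /and4P[b0 lt_ba le_n Hr] /eqP E; rewrite /= in E; subst a.
(* b = 1 forces the pair (2, 1); for larger b both parts can be lowered by one. *)
case: b b0 lt_ba le_n Hr => // -[|b] _ _ le_n Hr; [left|right]; apply/mapP.
  by exists r => //; rewrite mem_prev; move: Hr; rewrite !subSS subn0.
exists [:: b.+2, b.+1 & r] => //; rewrite IHp; last by lia.
rewrite arndt_of_cons2 /tight /= eqxx andbT.
have -> : n.+1 - (b.+2 + b.+1) = n.+3 - (b.+3 + b.+2) by lia.
by rewrite Hr; lia.
Qed.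

Lemma tight_uniq (n : nat) : uniq (tight_list prev n).
Proof.
have [p] := ubnP n; elim: p n => // p IHp [|[|[|n]]] // lt_np.
rewrite tight_listS cat_uniq !map_inj_uniq; try exact: incr_pair_inj; try exact: cons21_inj.
rewrite prev_uniq IHp ?andbT; last by lia.
(* The second part separates the two halves: it is 1 after [cons21] and at least 2 after
   [incr_pair]. *)
apply/hasPn => s /mapP[t]; rewrite mem_tight => /andP[Ht _] ->.
case: t Ht => [|a [|b t]] //; rewrite arndt_of_cons2 => /and4P[b0 _ _ _].
by apply/mapP => -[u _ [_ Eb _]]; lia.
Qed.

Lemma mem_extend (n : nat) (s : seq nat) :
  (s \in extend_list prev n) = arndt_of n m.+2 s.
Proof.
elim: n s => [|n IHn] s.
  case: s => [|a [|b r]]; rewrite ?arndt_of_cons2 ?arndt_of_short //.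
  by apply/esym/negP => /and4P[]; lia.
rewrite extend_listS mem_cat mem_tight.
case: s => [|a [|b r]].
- rewrite arndt_of_short //=; apply/mapP => -[[|c s]] //.
  by rewrite IHn arndt_of_short.
- rewrite arndt_of_short //=; apply/mapP => -[[|c s]] //.
  by rewrite IHn => H [_ Er]; move: H; rewrite -Er arndt_of_short.
apply/orP/idP => [[/andP[//]|/mapP[[|c [|d t]] //]]|].
  rewrite IHn !arndt_of_cons2 => /and4P[d0 lt_dc le_n Ht] [-> -> ->].
  by rewrite addSn subSS Ht; apply/and4P; split => //; lia.
rewrite arndt_of_cons2 => H; move: (H) => /and4P[b0 lt_ba le_n Hr].
rewrite /tight /= H; case: eqP => [|neq_ab]; [by left | right].
(* Since b < a and a is not b + 1, lowering a keeps the descent strict. *)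
apply/mapP; exists [:: a.-1, b & r]; last by case: a lt_ba {H le_n Hr neq_ab}.
rewrite IHn arndt_of_cons2.
have -> : n - (a.-1 + b) = n.+1 - (a + b) by lia.
by rewrite Hr; apply/and4P; split => //; lia.
Qed.

Lemma extend_uniq (n : nat) : uniq (extend_list prev n).
Proof.
elim: n => // n IHn; rewrite extend_listS cat_uniq tight_uniq.
rewrite (map_inj_uniq incr_head_inj) IHn andbT.
apply/hasPn => s /mapP[t]; rewrite mem_extend => Ht ->; rewrite mem_tight.
(* Raising a in a pair with b < a gives a + 1 > b + 1, never a tight pair. *)
apply/negP => /andP[_].
case: t Ht => [|a [|b t]]; rewrite ?arndt_of_cons2 ?arndt_of_short // /tight /=.
by case/and4P; lia.
Qed.

End Step.

Lemma arndt_listP (m n : nat) :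
  uniq (arndt_list m n) /\ forall s, (s \in arndt_list m n) = arndt_of n m s.
Proof.
have [p] := ubnP m; elim: p m n => // p IHp [|[|m]] n lt_mp.
- split=> [|s]; first by case: n.
  by case: n => [|n]; case: s.
- split=> [|s]; first by case: n.
  rewrite /arndt_of /is_composition.
  case: n => [|n]; case: s => [|a [|b s]] //=; rewrite ?inE ?addn0 ?andbT.
  + by case: a.
  + by case: a => // a; rewrite /= eqseq_cons eqxx andbT.
  by rewrite eqseq_cons andbF.
have U k : uniq (arndt_list m k) by case: (IHp m k); lia.
have M k s : (s \in arndt_list m k) = arndt_of k m s by case: (IHp m k); [lia|].
by split=> [|s]; [apply: (extend_uniq m _ U M) | apply: mem_extend].
Qed.

(** * Recurrences for the counts *)

Lemma arndt_countE (n m : nat) : arndt_count n m = size (arndt_list m n).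
Proof. by have [] := arndt_listP m n; apply: arndt_count_size. Qed.

(** Here [m] is the number of parts after the first pair, so these are coefficients of E_(m+2). *)
Definition tight_count (n m : nat) : nat := size (tight_list (arndt_list m) n).

Lemma arndt_countS (n m : nat) :
  arndt_count n.+1 m.+2 = tight_count n.+1 m + arndt_count n m.+2.
Proof. by rewrite !arndt_countE [arndt_list _ _]extend_listS size_cat size_map. Qed.

Lemma tight_countS (n m : nat) :
  tight_count n.+3 m = arndt_count n m + tight_count n.+1 m.
Proof. by rewrite arndt_countE /tight_count tight_listS size_cat !size_map. Qed.

End FirstPairRecursion.

(** * Power series coefficients and their match with the counts *)

Section Coefficients.

Definition conv (u v : nat -> rat) (N : nat) : rat :=
  \sum_(l < N.+1) u l * v (N - l)%N.

Lemma convC (u v : nat -> rat) (N : nat) : conv u v N = conv v u N.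
Proof.
rewrite /conv (reindex_inj rev_ord_inj) /=; apply: eq_bigr => i _.
by rewrite subSS subKn 1?mulrC // -ltnS.
Qed.

(* The hypotheses say that [u] has generating function [U (1 - c x)], where [U]
   is that of [u']. *)
Lemma convS (c : rat) (u u' v : nat -> rat) (N : nat) :
    u' 0%N = u 0%N -> (forall l, u' l.+1 = u l.+1 + c * u' l) ->
  conv u' v N.+1 = conv u v N.+1 + c * conv u' v N.
Proof.
move=> u0 uS; rewrite /conv big_ord_recl [in RHS]big_ord_recl /= u0 -addrA.
congr (_ + _); rewrite mulr_sumr -big_split /=; apply: eq_bigr => i _.
by rewrite /bump /= uS subSS; ring.
Qed.

(* Coefficients of [(1 - x)^(-m)]. *)
Definition negbin (m l : nat) : rat := binomz (m%:Z + l%:Z - 1) l.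

Lemma negbin0 (m : nat) : negbin m 0 = 1.
Proof. by rewrite /negbin /binomz big_ord0 fact0 divr1. Qed.

Lemma negbin0S (l : nat) : negbin 0 l.+1 = 0.
Proof.
rewrite /negbin /binomz big_ord_recr /=.
by rewrite (_ : _ - _ - _ = 0 :> int) ?mulr0 ?mul0r //; lia.
Qed.

Lemma negbinS (m l : nat) : negbin m.+1 l.+1 = negbin m l.+1 + negbin m.+1 l.
Proof.
rewrite /negbin /binomz.
have -> : m.+1%:Z + l%:Z - 1 = m%:Z + l.+1%:Z - 1 by lia.
set a : int := m%:Z + l.+1%:Z - 1.
have -> : m.+1%:Z + l.+1%:Z - 1 = a + 1 by rewrite /a; lia.
(* Pascal's rule: splitting off the top factor on the left and the lowest one on the right leaves
   the common product a(a-1)...(a-l+1). *)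
rewrite big_ord_recl [in RHS]big_ord_recr /=.
rewrite (eq_bigr (fun i : 'I_l => (a - i%:Z)%:~R)); last first.
  by move=> i _; congr _%:~R; rewrite /bump; lia.
set p := \prod_(i < l) _.
have nz : (l`!)%:R != 0 :> rat by rewrite pnatr_eq0 -lt0n fact_gt0.
have nzS : l%:R + 1 != 0 :> rat by rewrite natr1 pnatr_eq0.
rewrite factS natrM -natr1 !rmorphB !rmorphD /=.
by rewrite -!pmulrn; field; rewrite nzS nz.
Qed.

(* Coefficients of [(1 - x)^(-m) (1 + x)^(-k)]. *)
Definition arndt_coef (m k N : nat) : rat :=
  conv (negbin m) (fun j => negbin k j * (-1) ^+ j) N.

Lemma arndt_coef0 (m k : nat) : arndt_coef m k 0 = 1.
Proof. by rewrite /arndt_coef /conv big_ord1 !negbin0 expr0 !mulr1. Qed.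

Lemma arndt_coef_mS (m k N : nat) :
  arndt_coef m.+1 k N.+1 = arndt_coef m k N.+1 + arndt_coef m.+1 k N.
Proof.
rewrite -[arndt_coef m.+1 k N]mul1r; apply: convS; first by rewrite !negbin0.
by move=> l; rewrite mul1r negbinS.
Qed.

Lemma arndt_coef_kS (m k N : nat) :
  arndt_coef m k.+1 N.+1 = arndt_coef m k N.+1 - arndt_coef m k.+1 N.
Proof.
rewrite -[arndt_coef m k.+1 N]mul1r -mulNr /arndt_coef.
(* [convS] acts on the first factor, hence the swaps; it is used with c = -1. *)
rewrite convC [in X in X + _]convC [in X in _ + _ * X]convC.
apply: convS; first by rewrite !negbin0.
by move=> l; rewrite negbinS exprS; ring.
Qed.

Lemma arndt_coef_mkS1 (m k : nat) : arndt_coef m.+1 k.+1 1 = arndt_coef m k 1.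
Proof. by rewrite arndt_coef_mS arndt_coef_kS !arndt_coef0; ring. Qed.

(** Raising both exponents divides the series by (1 - x)(1 + x) = 1 - x^2. *)
Lemma arndt_coef_mkSS (m k N : nat) :
  arndt_coef m.+1 k.+1 N.+2 = arndt_coef m k N.+2 + arndt_coef m.+1 k.+1 N.
Proof. by rewrite !arndt_coef_mS !arndt_coef_kS; ring. Qed.

Lemma arndt_coef00S (N : nat) : arndt_coef 0 0 N.+1 = 0.
Proof.
rewrite /arndt_coef /conv big_ord_recl big1 ?negbin0S ?mul0r ?mulr0 ?addr0 //.
by move=> i _; rewrite negbin0S mul0r.
Qed.

Lemma arndt_coef10 (N : nat) : arndt_coef 1 0 N = 1.
Proof.
elim: N => [|N IHN]; first exact: arndt_coef0.
by rewrite arndt_coef_mS arndt_coef00S IHN add0r.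
Qed.

(** Solves (1 - x^2) E_(m+2) = x^3 C_m; each vanishing clause records the order of a series at 0. *)
Lemma tight_count_coef (m k : nat) :
    (forall n, (n < m + k)%N -> arndt_count n m = 0%N) ->
    (forall N, (arndt_count (m + k + N) m)%:R = arndt_coef m k N) ->
  (forall n, (n < m + k + 3)%N -> tight_count n m = 0%N) /\
  (forall N, (tight_count (m + k + 3 + N) m)%:R = arndt_coef m.+1 k.+1 N).
Proof.
move=> C0 CN.
have T0 n : (n < m + k + 3)%N -> tight_count n m = 0%N.
  have [p] := ubnP n; elim: p n => // p IHp [|[|[|n]]] // lt_np lt_n.
  by rewrite tight_countS C0 ?IHp //; lia.
split=> // N; have [p] := ubnP N; elim: p N => // p IHp N lt_Np.
have -> : (m + k + 3 + N = (m + k + N).+3)%N by lia.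
(* For N = 0 and N = 1 the remaining tight term lies below the lowest degree m + k + 3. *)
rewrite tight_countS natrD CN; case: N lt_Np => [|[|N]] lt_Np.
- by rewrite T0 ?addr0 ?arndt_coef0 //; lia.
- by rewrite T0 ?addr0 ?arndt_coef_mkS1 //; lia.
have -> : ((m + k + N.+2).+1 = m + k + 3 + N)%N by lia.
by rewrite IHp ?arndt_coef_mkSS //; lia.
Qed.

(** Induction on m in steps of two: the tight series has exponents m + 1 and k + 1, and dividing it
    by 1 - x raises the first to m + 2. *)
Lemma arndt_count_coef (m : nat) :
  (forall n, (n < m + m./2)%N -> arndt_count n m = 0%N) /\
  (forall N, (arndt_count (m + m./2 + N) m)%:R = arndt_coef m m./2 N).
Proof.
have [p] := ubnP m; elim: p m => // p IHp [|[|m]] lt_mp.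
- by split=> // -[|N]; rewrite arndt_countE /= ?arndt_coef0 ?arndt_coef00S.
- by split=> [[]|N] //; rewrite arndt_countE ?arndt_coef10.
have [|C0 CN] := IHp m; first by lia.
have [T0 TN] := tight_count_coef m m./2 C0 CN.
have -> : (m.+2 + m.+2./2 = m + m./2 + 3)%N by rewrite /=; lia.
have C0' n : (n < m + m./2 + 3)%N -> arndt_count n m.+2 = 0%N.
  elim: n => [|n IHn] lt_n; first by rewrite arndt_countE.
  by rewrite arndt_countS T0 ?IHn //; lia.
split=> // N; elim: N => [|N IHN] /=.
  rewrite addn0 (_ : (m + m./2 + 3 = (m + m./2 + 2).+1)%N); last by lia.
  rewrite arndt_countS natrD C0'; last by lia.
  rewrite (_ : ((m + m./2 + 2).+1 = m + m./2 + 3 + 0)%N); last by lia.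
  by rewrite TN !arndt_coef0 addr0.
by rewrite addnS arndt_countS natrD IHN -addnS TN -arndt_coef_mS.
Qed.

End Coefficients.

Theorem theorem2p2 :
  (forall n m : nat,
     (arndt_count n m)%:R =
       \sum_(0 <= l < (n.+1 - (m + m./2))%N)
          binomz (m%:Z + l%:Z - 1) l
          * binomz (n%:Z - m%:Z - l%:Z - 1) (n - m - m./2 - l)%N
          * (-1) ^+ (n - m - m./2 - l)%N :> rat)
  /\
  (forall n m : nat, (3 <= n)%N -> (2 <= m)%N ->
     (arndt_count n m)%:Z =
       (arndt_count (n - 1) m)%:Z + (arndt_count (n - 2) m)%:Z
       - (arndt_count (n - 3) m)%:Z + (arndt_count (n - 3) (m - 2))%:Z).
Proof.
split=> [n m|[|[|[|n]]] // [|[|m]] // _ _].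
  have [C0 CN] := arndt_count_coef m.
  have [lt_n|le_n] := ltnP n (m + m./2)%N.
    (* The truncated upper bound is 0, so the sum is empty. *)
    by rewrite C0 // big_geq //; lia.
  rewrite -(subnKC le_n) CN; set N := (n - _)%N.
  rewrite (_ : ((m + m./2 + N).+1 - (m + m./2) = N.+1)%N); last by lia.
  rewrite big_mkord; apply: eq_bigr => -[l /= lt_l] _.
  rewrite (_ : (m + m./2 + N - m - m./2 - l = N - l)%N); last by lia.
  (* With n = m + k + N, the upper entry n - m - l - 1 is k + (N - l) - 1. *)
  rewrite /negbin mulrA; congr (_ * binomz _ _ * _).
  by lia.
(* The three relations are linear; [tight_count n.+1 m] cancels between them. *)
rewrite !subSS !subn0 (arndt_countS n.+2) tight_countS (arndt_countS n).
by lia.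
Qed.
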